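(* Let $R_0 \in \mathrm{SO}(n)$ and $\mathcal{Z} \in \mathfrak{so}(n)$. If $I - \mathcal{Z}^T\mathcal{Z}$ is positive definite, then the normal correction term $R_0\mathbf{C} \in N_{R_0}\mathrm{SO}(n)$ that ensures $R = R_0 + R_0\mathcal{Z} + R_0\mathbf{C} \in \mathrm{SO}(n)$ is given by $$\mathbf{C} = \sqrt{I - \mathcal{Z}^T\mathcal{Z}} - I,$$ where $\sqrt{A}$ denotes the unique positive definite square root of the positive definite matrix $A$.
   Context: $\mathrm{SO}(n) = \{R \in \mathbb{R}^{n\times n} : R^TR = I,\ \det R = 1\}$ is the special orthogonal group, $I$ is the $n\times n$ identity matrix, and $\mathfrak{so}(n) = \{\mathcal{Z} \in \mathbb{R}^{n\times n} : \mathcal{Z}^T = -\mathcal{Z}\}$ is its Lie algebra. The tangent space of $\mathrm{SO}(n)$ at $R_0$ is $T_{R_0}\mathrm{SO}(n) = \{R_0\mathcal{Z} : \mathcal{Z} \in \mathfrak{so}(n)\}$, and the normal space at $R_0$ is its orthogonal complement in $\mathbb{R}^{n\times n}$, $N_{R_0}\mathrm{SO}(n) = \{R_0\mathbf{C} : \mathbf{C} \in \mathbb{R}^{n\times n},\ \mathbf{C} = \mathbf{C}^T\}$.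
   Formalization: The correction is shown to be unique only among those with I + C positive definite; without this, ''the'' correction is not unique (n = 2, R_0 = I, Z = 0: C = -2I gives R = -I in SO(2), besides C = 0). *)

(* Defs.v *)
From mathcomp Require Import all_boot all_order all_algebra.
From mathcomp Require Import boolp classical_sets reals.

Set Implicit Arguments.
Unset Strict Implicit.
Unset Printing Implicit Defensive.

Import Order.TTheory GRing.Theory Num.Theory.

Local Open Scope classical_set_scope.
Local Open Scope ring_scope.

Definition SO (R : realType) (n : nat) : set 'M[R]_n :=
  [set Q | Q^T *m Q = 1%:M /\ \det Q = 1].

Definition so (R : realType) (n : nat) : set 'M[R]_n :=
  [set Z | Z^T = - Z].
Arguments SO : clear implicits.
Arguments so : clear implicits.

Definition tangent_SO (R : realType) (n : nat) (R0 : 'M[R]_n) : set 'M[R]_n :=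
  [set R0 *m Z | Z in so R n].

Definition normal_SO (R : realType) (n : nat) (R0 : 'M[R]_n) : set 'M[R]_n :=
  [set R0 *m C | C in [set C : 'M[R]_n | C^T = C]].

(* The inner product of X and Y in R^(n x n) is \tr (X^T *m Y). *)
Lemma normal_SO_orthogonal (R : realType) (n : nat) (R0 : 'M[R]_n) :
  R0 \in SO R n ->
  normal_SO R0 =
    [set X | forall T, T \in tangent_SO R0 -> \tr (T^T *m X) = 0].
Proof.
rewrite inE => -[R0R0 _].
have R0R0' : R0 *m R0^T = 1%:M by apply: mulmx1C.
apply/seteqP; split => [_ [C /= CT <-] T|X /= ortX].
  rewrite inE => -[Z /= ZT <-].
  rewrite trmx_mul -mulmxA (mulmxA R0^T) R0R0 mul1mx ZT mulNmx raddfN /=.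
  have tE : \tr (Z *m C) = - \tr (Z *m C).
    by rewrite -{1}mxtrace_tr trmx_mul CT ZT mulmxN raddfN /= mxtrace_mulC.
  have : \tr (Z *m C) *+ 2 = 0 by rewrite mulr2n {1}tE addNr.
  by move/eqP; rewrite mulrn_eq0 /= => /eqP ->; rewrite oppr0.
exists (R0^T *m X); last by rewrite mulmxA R0R0' mul1mx.
rewrite /=; set C := R0^T *m X; set Z := C - C^T.
have ZT : Z^T = - Z by rewrite /Z linearB /= trmxK opprB.
have ZC : \tr (Z^T *m C) = 0.
  have := ortX (R0 *m Z); rewrite trmx_mul -mulmxA; apply.
  by rewrite inE; exists Z.
have ZCT : \tr (Z^T *m C^T) = 0.
  rewrite -mxtrace_tr trmx_mul !trmxK mxtrace_mulC.
  by move: ZC; rewrite ZT mulNmx raddfN /= => /eqP; rewrite oppr_eq0 => /eqP.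
have : \tr (Z^T *m Z) = 0 by rewrite {2}/Z mulmxBr linearB /= ZC ZCT subr0.
move=> trZ; suff : Z = 0 by move/eqP; rewrite subr_eq0 => /eqP <-.
have ge0 (j : 'I_n) : 0 <= \sum_i Z i j ^+ 2.
  by apply: sumr_ge0 => i _; exact: sqr_ge0.
have sumZ : \sum_j \sum_i Z i j ^+ 2 = 0.
  rewrite -[RHS]trZ /mxtrace; apply: eq_bigr => j _; rewrite [RHS]mxE.
  by apply: eq_bigr => i _; rewrite [Z^T j i]mxE expr2.
apply/matrixP => i j; rewrite [RHS]mxE; apply/eqP; rewrite -sqrf_eq0.
move/eqP: sumZ; rewrite psumr_eq0 => [|k _]; last exact: ge0.
move/allP => /(_ j); rewrite mem_index_enum => /(_ isT) /=.
rewrite psumr_eq0 => [|k _]; last exact: sqr_ge0.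
by move/allP => /(_ i); rewrite mem_index_enum => /(_ isT).
Qed.

Definition posdefmx (R : realType) (n : nat) (A : 'M[R]_n) : Prop :=
  A^T = A /\ forall x : 'cV[R]_n, x != 0 -> 0 < (x^T *m A *m x) 0 0.

Definition pd_sqrt (R : realType) (n : nat) (A : 'M[R]_n) : set 'M[R]_n :=
  [set S | posdefmx S /\ S *m S = A].

(* A chosen element of [pd_sqrt A]; the junk value 0 if there is none. *)
Definition sqrtmx (R : realType) (n : nat) (A : 'M[R]_n) : 'M[R]_n :=
  xget 0 (pd_sqrt A).

(* Main.v *)
Require Import Defs.
From mathcomp Require Import all_boot all_order all_algebra.
From mathcomp Require Import boolp classical_sets reals.
From mathcomp Require Import complex lra.

(** The columns of [R0] are orthonormal, so left multiplication by [R0] can be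
cancelled: with [S = 1 + C], the retracted point is [R0 (S + Z)], and the
question is for which positive definite [S] the matrix [S + Z] is a rotation.

Since [(S + Z)^T = S - Z], orthogonality says that [(S - Z)(S + Z)] and
[(S + Z)(S - Z)] are both the identity.  Adding and subtracting the two
equations, this means exactly that [S] commutes with [Z] and that
[S^2 = 1 + Z^2 = 1 - Z^T Z].  The determinant condition is then automatic
([det_posdef_skew_gt0]): the segment from the identity to [S + Z] consists of
matrices whose quadratic form is positive, hence of invertible matrices, so the
determinant keeps its sign along it.  This is [posdef_skew_SO].

It remains to know that the positive definite matrix [A = 1 - Z^T Z] has exactly
one positive definite square root and that this root commutes with [Z], which
commutes with [A].  Both follow once a square root is found among the
polynomials in [A] ([posdef_sqrt_exists]).  By the spectral theorem a polynomial
kills [A] as soon as it vanishes on the (positive) eigenvalues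
([symmx_horner_eq0]), so any polynomial interpolating the square root on the
eigenvalues gives a root of [A]. *)

Set Implicit Arguments.
Unset Strict Implicit.
Unset Printing Implicit Defensive.

Import Order.TTheory GRing.Theory Num.Theory.

Local Open Scope classical_set_scope.
Local Open Scope ring_scope.

(** * Polynomials in a symmetric matrix *)

Lemma interpolation_exists (F : fieldType) (s : seq F) (f : F -> F) :
  exists p : {poly F}, {in s, forall a, p.[a] = f a}.
Proof.
elim: s => [|b s [p ps]]; first by exists 0.
have [bs|bs] := boolP (b \in s).
  by exists p => a; rewrite inE => /predU1P[->|/ps//]; apply: ps.
pose q := \prod_(c <- s) ('X - c%:P).
have qb : q.[b] != 0 by have := root_prod_XsubC s b; rewrite (negPf bs) => /negbT.
exists (p + ((f b - p.[b]) / q.[b]) *: q) => a; rewrite inE hornerD hornerZ.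
move=> /predU1P[->|sa]; first by rewrite divfK // addrC subrK.
have /rootP -> : root q a by rewrite root_prod_XsubC.
by rewrite mulr0 addr0 ps.
Qed.

(** The part of the spectral theorem that is needed, freed of eigenbases: a real
symmetric matrix is annihilated by each polynomial vanishing on its spectrum, as
it becomes diagonal with real entries over the complex numbers. *)
Lemma symmx_horner_eq0 (R : rcfType) (n : nat) (A : 'M[R]_n.+1) :
  A^T = A ->
  exists s : seq R, {in s, forall a, eigenvalue A a} /\
    forall p : {poly R}, {in s, forall a, root p a} -> horner_mx A p = 0.
Proof.
move=> AT; pose toC := real_complex R : {rmorphism R -> R[i]}.
pose B := map_mx toC A.
have Bherm : B \is hermsymmx.
  apply/is_hermitianmxP; rewrite expr0 scale1r.
  apply/matrixP => i j; rewrite !mxE -[in LHS]AT mxE.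
  by rewrite /= /toC /=; simpc.
have Breal : spectral_diag B \is a realmx by apply: hermitian_spectral_diag_real.
have /orthomx_spectralP Beq := hermitian_normalmx Bherm.
set P := spectralmx B in Beq; set D := spectral_diag B in Breal Beq.
have Punit : P \in unitmx := spectral_unit B.
pose d i : R := complex.Re (D 0 i).
have dE i : D 0 i = toC (d i).
  have /mxOverP/(_ 0 i) := Breal.
  by rewrite /toC /d; case: (D 0 i) => a b /complex_realP[c [-> ->]].
(* [p] kills [A] exactly when it kills the diagonal form of [A]. *)
have hornerA p : horner_mx A p = 0 <-> forall i, root p (d i).
  have mapE : map_mx toC (horner_mx A p) =
      invmx P *m diag_mx (map_mx (horner (map_poly toC p)) D) *m P.
    by rewrite map_horner_mx -/B {1}Beq horner_mx_uconjC // horner_mx_diag.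
  split=> [pA0 i|pr].
    move: mapE; rewrite pA0 map_mx0 => /(congr1 (fun M => P *m M *m invmx P)).
    rewrite mulmx0 mul0mx !mulmxA mulmxV // mul1mx mulmxK //.
    move=> /matrixP/(_ i i); rewrite !mxE eqxx mulr1n dE horner_map => /eqP.
    by rewrite eq_sym fmorph_eq0.
  apply: (@map_mx_inj _ _ toC); rewrite mapE map_mx0.
  suff -> : map_mx (horner (map_poly toC p)) D = 0 by rewrite linear0 mulmx0 mul0mx.
  apply/matrixP => i j; rewrite !mxE ord1 dE horner_map.
  by rewrite (rootP (pr j)) rmorph0.
exists (codom d); split=> [_ /codomP[i ->]|p pr]; last first.
  by apply/hornerA => i; apply: pr; rewrite codom_f.
(* The diagonal entries are eigenvalues: the characteristic polynomial kills [A]. *)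
by rewrite eigenvalue_root_char; have /hornerA := Cayley_Hamilton A; apply.
Qed.

(** * Positive definite matrices and their square roots *)

Section PositiveDefinite.
Context {R : realType}.

Lemma normsq_gt0 (n : nat) (x : 'cV[R]_n) : x != 0 -> 0 < (x^T *m x) 0 0.
Proof.
move=> x0; have -> : (x^T *m x) 0 0 = \sum_i x i 0 ^+ 2.
  by rewrite mxE; apply: eq_bigr => i _; rewrite mxE expr2.
rewrite lt_neqAle sumr_ge0 ?andbT; last first.
  by move=> i _; rewrite sqr_ge0.
apply: contra x0; rewrite eq_sym psumr_eq0; last by move=> i _; rewrite sqr_ge0.
move=> /allP x0; apply/eqP/matrixP => i j; rewrite ord1 !mxE; apply/eqP.
by rewrite -sqrf_eq0; apply: x0; rewrite mem_index_enum.
Qed.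

Lemma posdef_eigenvalue_gt0 (n : nat) (A : 'M[R]_n) (a : R) :
  posdefmx A -> eigenvalue A a -> 0 < a.
Proof.
move=> [_ Apos] /eigenvalueP[v vA v0].
have vT0 : v^T != 0 by rewrite trmx_eq0.
have := Apos _ vT0; rewrite trmxK vA -scalemxAl mxE.
by rewrite pmulr_lgt0 // -{1}[v]trmxK normsq_gt0.
Qed.

Lemma unitmx_quadform (n : nat) (M : 'M[R]_n) :
  (forall x : 'cV[R]_n, x != 0 -> (x^T *m M *m x) 0 0 != 0) -> M \in unitmx.
Proof.
move=> Mx; rewrite -unitmx_tr -row_free_unit -kermx_eq0.
apply/negPn/negP=> /rowV0Pn[v /sub_kermxP vM v0].
have := Mx v^T; rewrite trmx_eq0 v0 => /(_ isT); rewrite -mulmxA.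
have -> : M *m v^T = 0 by rewrite -[M]trmxK -trmx_mul vM trmx0.
by rewrite mulmx0 mxE eqxx.
Qed.

Lemma posdef_unitmx (n : nat) (M : 'M[R]_n) : posdefmx M -> M \in unitmx.
Proof. by move=> [_ Mx]; apply: unitmx_quadform => x /Mx/lt0r_neq0. Qed.

Lemma posdef_sqr (n : nat) (T : 'M[R]_n) :
  T^T = T -> T \in unitmx -> posdefmx (T *m T).
Proof.
move=> TT Tu; split=> [|x x0]; first by rewrite trmx_mul TT.
have -> : x^T *m (T *m T) *m x = (T *m x)^T *m (T *m x).
  by rewrite trmx_mul TT !mulmxA.
apply: normsq_gt0; apply: contra x0 => /eqP Tx0.
by rewrite -[x](mulKmx Tu) Tx0 mulmx0.
Qed.

Lemma posdef_add (n : nat) (S T : 'M[R]_n) :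
  posdefmx S -> posdefmx T -> posdefmx (S + T).
Proof.
move=> [ST Sx] [TT Tx]; split=> [|x x0]; first by rewrite linearD /= ST TT.
by rewrite mulmxDr mulmxDl mxE addr_gt0 ?Sx ?Tx.
Qed.

Lemma horner_mx_tr (n : nat) (A : 'M[R]_n.+1) (p : {poly R}) :
  A^T = A -> (horner_mx A p)^T = horner_mx A p.
Proof.
move=> AT; elim/poly_ind: p => [|p c ihp]; first by rewrite rmorph0 trmx0.
rewrite rmorphD rmorphM /= horner_mx_X horner_mx_C linearD /= tr_scalar_mx.
by rewrite trmx_mul AT ihp; congr (_ + _); apply: comm_mx_horner.
Qed.

(** The root is a polynomial in [A], whence the commutation clause, which is what
uniqueness and the commutation with the tangent vector rest on.  Interpolating the
fourth root [T] rather than the square root makes positivity free: [T] is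
symmetric and invertible, so [T ^ 2] is positive definite. *)
Lemma posdef_sqrt_exists (n : nat) (A : 'M[R]_n) :
  posdefmx A -> exists S : 'M[R]_n,
    pd_sqrt A S /\ forall B : 'M[R]_n, comm_mx A B -> comm_mx S B.
Proof.
case: n A => [|n] A Apd.
  (* Polynomials can be evaluated only at matrices of size at least 1. *)
  exists A; split=> //; split=> //; by apply/matrixP => -[].
have [AT _] := Apd; have [s [seig hornerA]] := symmx_horner_eq0 AT.
have [q qs] := interpolation_exists s (fun a => Num.sqrt (Num.sqrt a)).
have TTTT : horner_mx A ((q ^+ 2) ^+ 2) = A.
  apply/eqP; rewrite -subr_eq0 -{2}[A]horner_mx_X -rmorphB; apply/eqP.
  apply: hornerA => a sa; apply/rootP; rewrite !hornerE qs //.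
  have a0 := posdef_eigenvalue_gt0 Apd (seig _ sa).
  by rewrite !sqr_sqrtr ?sqrtr_ge0 ?ltW // subrr.
pose T := horner_mx A q.
have SE : horner_mx A (q ^+ 2) = T *m T by rewrite rmorphXn expr2.
have SS : (T *m T) *m (T *m T) = A
  by rewrite -[RHS]TTTT [X in horner_mx A X]expr2 rmorphM /= SE.
exists (T *m T); split; last by move=> B AB; rewrite -SE; apply: comm_horner_mx.
split=> //; apply: posdef_sqr; first exact: horner_mx_tr.
by have := posdef_unitmx Apd; rewrite -SS !unitmx_mul => /andP[/andP[]].
Qed.

(** For commuting roots [(S - T)(S + T) = 0], and [S + T] is invertible. *)
Lemma posdef_sqrt_uniq (n : nat) (S T : 'M[R]_n) :
  posdefmx S -> posdefmx T -> comm_mx S T -> S *m S = T *m T -> S = T.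
Proof.
move=> Spd Tpd ST SSTT; apply/eqP; rewrite -subr_eq0; apply/eqP.
apply: (can_inj (mulmxK (posdef_unitmx (posdef_add Spd Tpd)))).
by rewrite mul0mx mulmxBl !mulmxDr SSTT ST [_ + T *m T]addrC subrr.
Qed.

Lemma pd_sqrtE (n : nat) (A : 'M[R]_n) :
  posdefmx A -> pd_sqrt A = [set sqrtmx A].
Proof.
move=> Apd; have [S [SA Scomm]] := posdef_sqrt_exists Apd.
have uniqS T : pd_sqrt A T -> T = S.
  move=> [Tpd TTA]; have [Spd SSA] := SA.
  apply/esym/posdef_sqrt_uniq => //; last by rewrite SSA.
  by apply: Scomm; rewrite /comm_mx -TTA mulmxA.
have SE : sqrtmx A = S by apply: uniqS; apply: xgetI SA.
by rewrite SE; apply/seteqP; split=> [T /uniqS|_ ->].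
Qed.

Lemma sqrtmx_comm (n : nat) (A B : 'M[R]_n) :
  posdefmx A -> comm_mx A B -> comm_mx (sqrtmx A) B.
Proof.
move=> Apd AB; have [S [SA Scomm]] := posdef_sqrt_exists Apd.
by move: SA; rewrite pd_sqrtE // => <-; apply: Scomm.
Qed.

(** [M] need not be symmetric.  The determinant of [(1 - t) + t M] is a polynomial
in [t] equal to 1 at [t = 0]; by the intermediate value theorem, a nonpositive value
at [t = 1] would give a singular matrix on the segment, whose quadratic form is
nevertheless positive. *)
Lemma det_gt0_quadform (n : nat) (M : 'M[R]_n) :
  (forall x : 'cV[R]_n, x != 0 -> 0 < (x^T *m M *m x) 0 0) -> 0 < \det M.
Proof.
move=> Mx.
pose p : {poly R} := \det ((1 - 'X)%:M + 'X *: map_mx polyC M).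
have pE t : p.[t] = \det ((1 - t)%:M + t *: M).
  rewrite -horner_evalE -det_map_mx; congr (\det _).
  apply/matrixP => i j; rewrite !mxE.
  by rewrite [LHS]horner_evalE !(hornerE, hornerMn).
have p1 : p.[1] = \det M by rewrite pE subrr scale1r raddf0 add0r.
have p0 : p.[0] = 1 by rewrite pE subr0 scale0r addr0 det1.
rewrite -p1 ltNge; apply/negP => p1le0.
have [||t] := @poly_ivt R (- p) 0 1; first exact: ler01.
  by rewrite !hornerN p0 oppr_le0 ler01 oppr_ge0.
move=> /andP[t0 t1]; rewrite rootN => /rootP; rewrite pE => /eqP.
apply/negP; rewrite -unitfE -unitmxE; apply: unitmx_quadform => x x0.
apply: lt0r_neq0; rewrite mulmxDr mulmxDl mul_mx_scalar.
rewrite -scalemxAr -!scalemxAl mxE [X in X + _]mxE [X in _ + X]mxE.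
move: t0; rewrite le_eqVlt => /predU1P[<-|t0].
  by rewrite subr0 mul1r mul0r addr0 normsq_gt0.
by rewrite ltr_wpDl ?mulr_ge0 ?subr_ge0 ?mulr_gt0 ?Mx // ltW // normsq_gt0.
Qed.

End PositiveDefinite.

(** * Rotations with a given skew-symmetric part *)

Section SkewSymmetric.
Context {R : realType} {n : nat}.
Implicit Types (S Z : 'M[R]_n).

Lemma skew_quadform Z (x : 'cV[R]_n) : Z^T = - Z -> (x^T *m Z *m x) 0 0 = 0.
Proof.
move=> ZT; set q := _ *m _.
have : q^T = - q by rewrite /q !trmx_mul trmxK ZT mulmxA mulmxN mulNmx.
move: q => q /matrixP/(_ 0 0); rewrite !mxE => /eqP.
by rewrite -addr_eq0 -mulr2n mulrn_eq0 => /eqP.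
Qed.

Lemma det_posdef_skew_gt0 S Z : posdefmx S -> Z^T = - Z -> 0 < \det (S + Z).
Proof.
move=> [_ Sx] ZT; apply: det_gt0_quadform => x x0.
by rewrite mulmxDr mulmxDl mxE (skew_quadform x ZT) addr0 Sx.
Qed.

(** A rotation is orthogonal on both sides, [(S - Z)(S + Z) = 1 = (S + Z)(S - Z)];
the half-difference of these equations is the commutation of [S] and [Z], the
half-sum is the value of [S ^ 2]. *)
Lemma posdef_skew_SO S Z : posdefmx S -> Z^T = - Z ->
  (S + Z \in SO R n) <-> comm_mx S Z /\ S *m S = 1%:M - Z^T *m Z.
Proof.
move=> Spd ZT; have [ST _] := Spd.
have MT : (S + Z)^T = S - Z by rewrite linearD /= ST ZT.
rewrite ZT mulNmx opprK; split.
  rewrite inE => -[MM _]; have MM' := mulmx1C MM.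
  move: MM MM'; rewrite MT !mulmxDl !mulmxDr !mulNmx !mulmxN.
  rewrite /comm_mx; move: (S *m S) (S *m Z) (Z *m S) (Z *m Z) => SS SZ ZS ZZ E E'.
  have Eij i j : SS i j + SZ i j + (- ZS i j - ZZ i j) = 1%:M i j.
    by rewrite -E !mxE.
  have Eij' i j : SS i j - SZ i j + (ZS i j - ZZ i j) = 1%:M i j.
    by rewrite -E' !mxE.
  split; apply/matrixP => i j; first by have := Eij i j; rewrite -Eij' => ?; lra.
  by rewrite [RHS]mxE; have := Eij i j; have := Eij' i j; lra.
move=> [SZ SS]; have MM : (S + Z)^T *m (S + Z) = 1%:M.
  by rewrite MT mulmxBl !mulmxDr SS SZ opprD addrA addrK addrK.
rewrite inE; split=> //.
have /eqP : \det (S + Z) ^+ 2 = 1 by rewrite expr2 -{1}det_tr -det_mulmx MM det1.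
rewrite sqrf_eq1 => /orP[/eqP//|/eqP dN1].
by have := det_posdef_skew_gt0 Spd ZT; rewrite dN1 oppr_gt0 ltr10.
Qed.

Lemma SO_mull (Q : 'M[R]_n) S : Q \in SO R n -> (Q *m S \in SO R n) = (S \in SO R n).
Proof.
rewrite inE => -[QQ dQ]; suff E : SO R n (Q *m S) = SO R n S.
  by apply/idP/idP; rewrite !inE E.
by rewrite /SO /= trmx_mul det_mulmx dQ mul1r -mulmxA (mulmxA Q^T) QQ mul1mx.
Qed.

End SkewSymmetric.

(** * The normal correction *)

Theorem theorem1 (R : realType) (n : nat) (R0 Z : 'M[R]_n)
    (hR0 : R0 \in SO R n) (hZ : Z \in so R n)
    (hpos : posdefmx (1%:M - Z^T *m Z)) :
  let A := 1%:M - Z^T *m Z in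
  let C := sqrtmx A - 1%:M in
  [/\ pd_sqrt A = [set sqrtmx A],
      R0 *m C \in normal_SO R0,
      R0 + R0 *m Z + R0 *m C \in SO R n
    & forall C' : 'M[R]_n,
        R0 *m C' \in normal_SO R0 ->
        R0 + R0 *m Z + R0 *m C' \in SO R n ->
        posdefmx (1%:M + C') ->
        C' = C].
Proof.
move=> A C; have ZT : Z^T = - Z by move: hZ; rewrite inE.
have retractE C' :
    (R0 + R0 *m Z + R0 *m C' \in SO R n) = ((1%:M + C') + Z \in SO R n).
  by rewrite -[X in X + _ + _]mulmx1 -!mulmxDr SO_mull // addrAC.
have sqrtE := pd_sqrtE hpos.
have [Spd SS] : pd_sqrt A (sqrtmx A) by rewrite sqrtE.
have [ST _] := Spd.
split=> // [||C' C'normal C'SO C'pd].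
- by rewrite inE; exists C; rewrite //= /C linearB /= ST trmx1.
- rewrite retractE /C [1%:M + _]addrC subrK; apply/posdef_skew_SO => //; split=> //.
  apply: sqrtmx_comm => //; rewrite /comm_mx /A ZT mulNmx opprK.
  by rewrite mulmxDl mulmxDr mulmx1 mul1mx mulmxA.
- move: C'SO; rewrite retractE => /posdef_skew_SO[//|//|_ SS'].
  have : pd_sqrt A (1%:M + C') by [].
  by rewrite sqrtE /C => <-; rewrite addrC addKr.
Qed.
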